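(* Let $X$ be a nonempty Borel space, $Q$ a stochastic kernel on $X$, and $\Phi,\Psi\subset X$ Borel measurable sets. Define recursively $V_0 := \mathbf 1_{\Psi}$ and $V_{k+1} := L[V_k]$ for $k\ge 0$, where $$L[W](x) := \mathbf 1_{\Psi}(x) + \mathbf 1_{\Phi\setminus\Psi}(x)\int_X Q(x,\mathrm d\xi)\,W(\xi).$$ Then for all $k\ge 0$ and all $x\in X$, $$V_k(x) = \mathbb P_x\bigl(\Phi\ \mathcal U^{\le k}\ \Psi\bigr).$$ Moreover, for every $x\in X$ the sequence $(V_k(x))_{k\ge 0}$ is nondecreasing.
   Context: A Borel space is a Borel subset $X$ of a Polish space, with Borel $\sigma$-algebra $\mathfrak B(X)$; ''measurable'' means Borel measurable. A stochastic kernel on $X$ is a map $Q:X\times\mathfrak B(X)\to[0,1]$ such that $Q(x,\cdot)$ is a probability measure for each $x\in X$ and $Q(\cdot,B)$ is measurable for each $B\in\mathfrak B(X)$. Let $\Omega:=\prod_{i=0}^\infty X$ with the product $\sigma$-algebra and coordinate process $X_t(\omega)=\omega(t)$, $t\in\mathbb N_0=\{0,1,2,\dots\}$. For $x\in X$, $\mathbb P_x$ is the unique probability measure on $\Omega$ with $\mathbb P_x(X_0\in B)=\delta_x(B)$ and $\mathbb P_x(X_{t+1}\in B\mid X_0,\dots,X_t)=Q(X_t,B)$ for all $B\in\mathfrak B(X)$, $t\in\mathbb N_0$ (the Markov chain with kernel $Q$ started at $x$). The operator $L$ acts on the set $\mathcal M_b(X)$ of bounded measurable functions $X\to\mathbb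 R$. $\mathbf 1_A$ is the indicator function of $A$. The ''bounded until'' event is $$\{\Phi\ \mathcal U^{\le k}\ \Psi\} := \{\omega\in\Omega:\ \exists\, i\in\{0,\dots,k\}\text{ such that }\omega(i)\in\Psi\text{ and }\omega(j)\in\Phi\text{ for all }0\le j<i\}.$$ *)

(* Defs.v *)
From HB Require Import structures.
From mathcomp Require Import all_boot all_order all_algebra.
From mathcomp Require Import all_classical all_reals all_analysis.
From mathcomp Require Import measurable_realfun.

Set Implicit Arguments.
Unset Strict Implicit.
Unset Printing Implicit Defensive.

Import Order.TTheory GRing.Theory Num.Theory.
Import numFieldNormedType.Exports.

Local Open Scope classical_set_scope.
Local Open Scope ring_scope.

Definition separable (Y : topologicalType) : Prop :=
  exists2 D : set Y, countable D & dense D.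

(* Homeomorphic to a complete metric space; equivalently, the topology of Y is
   induced by some complete metric. *)
Definition completely_metrizable (R : realType) (Y : topologicalType) : Prop :=
  exists (M : metricType R) (f : Y -> M) (g : M -> Y),
    [/\ cancel f g, cancel g f, continuous f, continuous g
      & forall F : set_system M, ProperFilter F -> cauchy F ->
          exists l : M, F --> l].

Definition polish (R : realType) (Y : topologicalType) : Prop :=
  separable Y /\ completely_metrizable R Y.

(* A measurableType must be pointed, hence the proof of nonemptiness; the base
   point plays no other role. *)
Definition subset_type (Y : topologicalType) (E : set Y) (E0 : E !=set0) : Type :=
  set_type E.

HB.instance Definition _ (Y : topologicalType) (E : set Y) (E0 : E !=set0) :=
  Topological.copy (subset_type E0) (set_type E).

HB.instance Definition _ (Y : topologicalType) (E : set Y) (E0 : E !=set0) :=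
  isPointed.Build (subset_type E0)
    (exist _ (sval (cid E0)) (mem_set (svalP (cid E0)))).

(* E with the Borel sigma-algebra of its subspace topology. *)
Definition borel_space (Y : topologicalType) (E : set Y) (E0 : E !=set0) :=
  g_sigma_algebraType (@open (subset_type E0)).

Section markov_chain.
Context {d : measure_display} {X : measurableType d} {R : realType}.

Definition cylinders : set (set (nat -> X)) :=
  \bigcup_t preimage_set_system setT (fun w : nat -> X => w t) measurable.

(* Omega = X^N with the product sigma-algebra. *)
Definition path_space := g_sigma_algebraType cylinders.

(* sigma(X_0, ..., X_t) *)
Definition history (t : nat) : set (set path_space) :=
  g_sigma_preimage (fun (i : 'I_t.+1) (w : path_space) => w i).

(* Z is a version of the conditional probability P(A | G), where G is a
   sub-sigma-algebra of the measurable sets. *)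
Definition is_cond_prob {d' : measure_display} {T : measurableType d'}
    (P : probability T R) (G : set (set T)) (A : set T) (Z : T -> \bar R) :
    Prop :=
  [/\ forall B : set (\bar R), measurable B -> G (Z @^-1` B),
      P.-integrable setT Z
    & forall C : set T, G C -> (\int[P]_(w in C) Z w = P (A `&` C))%E].

(* P is the law of the Markov chain with kernel Q started at x. *)
Definition markov_law (Q : R.-pker X ~> X) (x : X)
    (P : probability path_space R) : Prop :=
  (forall B : set X, measurable B ->
     P [set w : path_space | B (w 0%N)] = (\d_x B)%E) /\
  (forall (t : nat) (B : set X), measurable B ->
     is_cond_prob P (history t) [set w : path_space | B (w t.+1)]
       (fun w => Q (w t) B)).

Definition bounded_until (Phi Psi : set X) (k : nat) : set path_space :=
  [set w : path_space | exists i : nat,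
    [/\ (i <= k)%N, Psi (w i) & forall j : nat, (j < i)%N -> Phi (w j)]].

(* Only meant for bounded measurable W: Rintegral is 0 when the integral is not
   finite. *)
Definition reach_op (Q : R.-pker X ~> X) (Phi Psi : set X) (W : X -> R) :
    X -> R :=
  fun x => \1_Psi x + \1_(Phi `\` Psi) x * \int[Q x]_xi W xi.

Fixpoint value_fun (Q : R.-pker X ~> X) (Phi Psi : set X) (k : nat) : X -> R :=
  match k with
  | 0%N => \1_Psi
  | k'.+1 => reach_op Q Phi Psi (value_fun Q Phi Psi k')
  end.

End markov_chain.

Arguments path_space {d} X.

(* Main.v *)
(* For the chain started at x, let S_t be the event that X_0, ..., X_(t-1) all
   lie in Phi `\` Psi. By induction on n, for all t at once, the integral of
   V_n(X_t) over S_t is the probability that S_t holds and that the path shifted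
   by t satisfies Phi U^{<= n} Psi: unfolding V_(n+1)(X_t) splits off the event
   S_t /\ {X_t in Psi}, and what remains is the integral over S_(t+1) of the
   one-step average of V_n from X_t, which is the integral of V_n(X_(t+1)) over
   S_(t+1) because S_(t+1) belongs to the history of X_0, ..., X_t. Taking t = 0
   gives V_n(x). Working forwards along one law avoids shifted path measures and
   the existence of laws from other starting points. Monotonicity in k holds
   because V_0 <= V_1 and reach_op is monotone. *)

Require Import Defs.
From HB Require Import structures.
From mathcomp Require Import all_boot all_order all_algebra.
From mathcomp Require Import all_classical all_reals all_analysis.
From mathcomp Require Import measurable_realfun.

Set Implicit Arguments.
Unset Strict Implicit.
Unset Printing Implicit Defensive.

Import Order.TTheory GRing.Theory Num.Theory.
Import numFieldNormedType.Exports.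

Local Open Scope classical_set_scope.
Local Open Scope ring_scope.

(** * Integrals of nonnegative functions against mixtures of measures *)

Section mixture.
Local Open Scope ereal_scope.
Context {d d' : measure_display} {T : measurableType d} {X : measurableType d'}
  {R : realType}.
Variables (mu : {measure set T -> \bar R}) (C : set T) (mC : measurable C).
Implicit Types k : T -> {measure set X -> \bar R}.

Import HBNNSimple.

Lemma integral_sintegral_kernel k (h : {nnsfun X >-> R}) :
  (forall B, measurable B -> measurable_fun setT (k ^~ B)) ->
  \int[mu]_(w in C) sintegral (k w) h =
  \sum_(r \in range h) r%:E * \int[mu]_(w in C) k w (h @^-1` [set r]).
Proof.
move=> mk; have mkC B : measurable B -> measurable_fun C (k ^~ B).
  by move=> mB; apply: measurable_funTS; exact: mk.
under eq_integral do rewrite sintegralE.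
rewrite ge0_integral_fsum//; last 2 first.
- by move=> r; apply: measurable_funeM; exact: mkC.
- by move=> r w _; exact: nnsfun_mulemu_ge0.
(* Membership in the range makes [r] a value of [h], hence nonnegative, as needed to pull it out of
   the integral. *)
apply: eq_fsbigr => r /[!inE] -[x _ <-].
by rewrite -ge0_integralZl//; [exact: mkC|rewrite lee_fin].
Qed.

(** Monotone convergence is used twice along a single approximation of [f]: under each [k w], then
    under [mu]. *)
Lemma integral_kernelE k (f : X -> \bar R) (mf : measurable_fun setT f) :
  (forall B, measurable B -> measurable_fun setT (k ^~ B)) ->
  (forall x, 0 <= f x) ->
  \int[mu]_(w in C) \int[k w]_x f x =
  limn (fun n => \int[mu]_(w in C)
    sintegral (k w) (nnsfun_approx measurableT mf n)).
Proof.
move=> mk f0.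
pose g n : X -> \bar R := EFin \o nnsfun_approx measurableT mf n.
have mg n : measurable_fun setT (g n) by exact/measurable_EFinP.
have g0 n x : 0 <= g n x by rewrite lee_fin.
have nd_g x : {homo g ^~ x : n m / (n <= m)%O >-> n <= m}.
  by move=> *; exact/lefP/nd_nnsfun_approx.
have fE x : limn (g ^~ x) = f x.
  by apply/cvg_lim => //; exact: cvg_nnsfun_approx.
transitivity (\int[mu]_(w in C) limn (fun n => \int[k w]_x g n x)).
  apply: eq_integral => w _.
  by rewrite -monotone_convergence//; apply: eq_integral => x _.
rewrite monotone_convergence//.
- apply: congr_lim; apply/funext => n; apply: eq_integral => w _.
  by rewrite integralT_nnsfun.
- move=> n; apply: measurable_funTS.
  by apply: measurable_fun_integral_kernel.
- by move=> n w _; exact: integral_ge0.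
- by move=> w _ m n mn; apply: ge0_le_integral => // x _; exact: nd_g.
Qed.

(** Simple functions only see the averaged masses of measurable sets, and limits of them inherit
    this. The lemma turns the clauses of [markov_law], which concern events, into identities for
    functions. *)
Lemma eq_integral_kernel k1 k2 (f : X -> \bar R) :
  (forall B, measurable B -> measurable_fun setT (k1 ^~ B)) ->
  (forall B, measurable B -> measurable_fun setT (k2 ^~ B)) ->
  (forall B, measurable B ->
     \int[mu]_(w in C) k1 w B = \int[mu]_(w in C) k2 w B) ->
  measurable_fun setT f -> (forall x, 0 <= f x) ->
  \int[mu]_(w in C) \int[k1 w]_x f x = \int[mu]_(w in C) \int[k2 w]_x f x.
Proof.
move=> mk1 mk2 k12 mf f0; rewrite !(integral_kernelE mf)//.
apply: congr_lim; apply/funext => n; rewrite !integral_sintegral_kernel//.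
by apply: eq_fsbigr => r _; rewrite k12.
Qed.

End mixture.

(** * Coordinates of the path space and the events they determine *)

Section reachability.
Context {d : measure_display} {X : measurableType d} {R : realType}.
Implicit Types (Q : R.-pker X ~> X) (Phi Psi B : set X).

Lemma measurable_coordinate (t : nat) :
  measurable_fun setT (fun w : path_space X => w t).
Proof.
move=> _ B mB; apply: sub_sigma_algebra.
by exists t => //; exists B.
Qed.

Lemma measurable_at B (t : nat) :
  measurable B -> measurable [set w : path_space X | B (w t)].
Proof.
by move=> mB; rewrite -[X in measurable X]setTI; exact: measurable_coordinate.
Qed.

Lemma measurable_comp_coordinate (g : X -> \bar R) (t : nat) :
  measurable_fun setT g ->
  measurable_fun setT (fun w : path_space X => g (w t)).
Proof. by move=> mg; exact: measurableT_comp mg (measurable_coordinate t). Qed.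

Definition stays_in B (t : nat) : set (path_space X) :=
  [set w | forall j, (j < t)%N -> B (w j)].

Lemma stays_inS B t :
  stays_in B t.+1 = stays_in B t `&` [set w | B (w t)].
Proof.
apply/seteqP; split => [w Bw|w [Bw Bt] j]; last first.
  by rewrite ltnS leq_eqVlt => /predU1P[->|] //; exact: Bw.
by split => [j jt|]; apply: Bw => //; exact: ltnW.
Qed.

(** Since [stays_in] uses a strict bound, [t.+1] constrains times 0 to [t] only, exactly the
    coordinates that generate [history t]. *)
Lemma history_stays_in B (t : nat) :
  measurable B -> history t (stays_in B t.+1).
Proof.
move=> mB.
have -> : stays_in B t.+1 =
    \bigcap_(j in [set: 'I_t.+1]) [set w : path_space X | B (w j)].
  apply/seteqP; split => [w Bw j _|w Bw j jt]; first exact: Bw.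
  exact: (Bw (Ordinal jt)).
rewrite /history /g_sigma_preimage; set H := (X in <<s X >>).
apply: (@fin_bigcap_measurable _ (g_sigma_algebraType H)) => // j _.
(* The generating family, a big union over ordinals, becomes a union over naturals below [t.+1]
   reindexed by [inord]. *)
apply: sub_sigma_algebra; rewrite /H -bigcup_mkord_ord.
by exists j; [exact: ltn_ord|exists B => //; rewrite inord_val setTI].
Qed.

Lemma measurable_stays_in B t : measurable B -> measurable (stays_in B t).
Proof.
move=> mB; elim: t => [|t IH].
  by rewrite (_ : stays_in B 0 = setT)//; apply/seteqP; split.
rewrite stays_inS; apply: measurableI => //.
exact: measurable_at.
Qed.

(** * Initial and one-step identities for functions under a Markov law *)

Section law.
Local Open Scope ereal_scope.
Variables (Q : R.-pker X ~> X) (x : X) (P : probability (path_space X) R).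
Hypothesis lawP : markov_law Q x P.
Variables (f : X -> \bar R).
Hypotheses (mf : measurable_fun setT f) (f0 : forall y, 0 <= f y).

Lemma markov_law_initial : \int[P]_w f (w 0%N) = f x.
Proof.
(* Evaluation is integration against a Dirac mass, so the claim compares the kernel [\d_(w 0)] with
   the constant kernel [\d_x]. *)
transitivity (\int[P]_w \int[\d_(w 0%N)]_y f y).
  by apply: eq_integral => w _; rewrite integral_dirac// diracT mul1e.
transitivity (\int[P]_w \int[\d_x]_y f y); last first.
  rewrite integral_dirac// diracT mul1e.
  by rewrite integral_cst//= probability_setT mule1.
apply: eq_integral_kernel => // B mB.
  apply: (measurable_comp_coordinate (g := fun y => \d_y B)).
  exact: measurable_fun_dirac.
transitivity (P [set w : path_space X | B (w 0%N)]).
  by rewrite -[in RHS](setIT [set _ | _]) -integral_indic//;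
    exact: measurable_at.
by rewrite lawP.1// integral_cst//= probability_setT mule1.
Qed.

(** The kernels [\d_(w t.+1)] and [Q (w t)] give each [B] the same average over [C]: this is the
    defining property of conditional probability, available because [C] is in the history. *)
Lemma markov_law_step t (C : set (path_space X)) :
    measurable C -> history t C ->
  \int[P]_(w in C) f (w t.+1) = \int[P]_(w in C) \int[Q (w t)]_y f y.
Proof.
move=> mC hC.
transitivity (\int[P]_(w in C) \int[\d_(w t.+1)]_y f y).
  by apply: eq_integral => w _; rewrite integral_dirac// diracT mul1e.
apply: eq_integral_kernel => // B mB.
- apply: (measurable_comp_coordinate (g := fun y => \d_y B)).
  exact: measurable_fun_dirac.
- apply: (measurable_comp_coordinate (g := Q ^~ B)).
  exact: measurable_kernel.
have [_ _ ->//] := lawP.2 t B mB.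
rewrite -integral_indic//.
exact: measurable_at.
Qed.

End law.

(** * The operator on functions with values in the unit interval *)

Section reach_op.
Variables (Q : R.-pker X ~> X) (Phi Psi : set X).
Hypotheses (mPhi : measurable Phi) (mPsi : measurable Psi).

(** This class is stable under [reach_op], and on it the integrals are finite, so the default value
    of [Rintegral] never arises. *)
Definition unit_valued (W : X -> R) :=
  measurable_fun setT W /\ forall x, 0 <= W x <= 1.

Lemma unit_valued_integral (W : X -> R) (x : X) : unit_valued W ->
  (0 <= \int[Q x]_y (W y)%:E <= 1)%E.
Proof.
move=> [mW W01]; apply/andP; split.
  by apply: integral_ge0 => y _; rewrite lee_fin; case/andP: (W01 y).
rewrite -[leRHS](@prob_kernel _ _ _ _ _ Q x) -[leRHS]mul1e.
rewrite -integral_cst//; apply: ge0_le_integral => //.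
- by move=> y _; rewrite lee_fin; case/andP: (W01 y).
- exact/measurable_EFinP.
- by move=> y _; rewrite lee_fin; case/andP: (W01 y).
Qed.

Lemma Rintegral_unit_valued (W : X -> R) (x : X) : unit_valued W ->
  (\int[Q x]_y W y)%:E = (\int[Q x]_y (W y)%:E)%E.
Proof.
move=> /(unit_valued_integral x)/andP[I0 I1].
rewrite /Rintegral fineK// ge0_fin_numE//.
by rewrite (le_lt_trans I1)// ltry.
Qed.

Lemma reach_opE (W : X -> R) (x : X) :
  reach_op Q Phi Psi W x =
    if x \in Psi then 1 else if x \in Phi then \int[Q x]_y W y else 0.
Proof.
rewrite /reach_op !indicE in_setD.
by case: (x \in Psi); case: (x \in Phi);
  rewrite /= ?(mul0r, mul1r, addr0, add0r).
Qed.

Lemma unit_valued_reach_op (W : X -> R) :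
  unit_valued W -> unit_valued (reach_op Q Phi Psi W).
Proof.
move=> uW; split.
  apply: measurable_funD; first exact: measurable_indic.
  apply: measurable_funM; first by apply: measurable_indic; exact: measurableD.
  apply/measurable_EFinP.
  rewrite (_ : _ \o _ = fun x => (\int[Q x]_y (W y)%:E)%E); last first.
    by apply/funext => x /=; rewrite Rintegral_unit_valued.
  apply: measurable_fun_integral_kernel => [B mB|y|].
  - exact: measurable_kernel.
  - by rewrite lee_fin; case/andP: (uW.2 y).
  - by apply/measurable_EFinP; exact: uW.1.
move=> x; rewrite reach_opE; case: ifPn => _; first by rewrite ler01 lexx.
case: ifPn => _; last by rewrite lexx ler01.
by rewrite -!lee_fin Rintegral_unit_valued// unit_valued_integral.
Qed.

Lemma unit_valued_value_fun k : unit_valued (value_fun Q Phi Psi k).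
Proof.
elim: k => [|k IH]; last exact: unit_valued_reach_op.
split; first exact: measurable_indic.
by move=> x; rewrite /= indicE; case: (_ \in _); rewrite ?lexx ?ler01.
Qed.

Lemma le_reach_op (W1 W2 : X -> R) : unit_valued W1 -> unit_valued W2 ->
  (forall x, W1 x <= W2 x) ->
  forall x, reach_op Q Phi Psi W1 x <= reach_op Q Phi Psi W2 x.
Proof.
move=> uW1 uW2 W12 x; rewrite !reach_opE.
case: ifPn => // _; case: ifPn => // _.
rewrite -lee_fin !Rintegral_unit_valued//; apply: ge0_le_integral => //.
- by move=> y _; rewrite lee_fin; case/andP: (uW1.2 y).
- by apply/measurable_EFinP; exact: uW1.1.
- by apply/measurable_EFinP; exact: uW2.1.
- by move=> y _; rewrite lee_fin.
Qed.

Lemma nondecreasing_value_fun (x : X) :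
  nondecreasing_seq (fun k => value_fun Q Phi Psi k x).
Proof.
apply/nondecreasing_seqP => k; elim: k x => [|k IH] x.
  (* On [Psi] both sides are 1; off [Psi] the left side is 0 and nonnegativity suffices. *)
  rewrite /= reach_opE indicE; case: (_ \in Psi) => //.
  case: ifPn => // _; apply: Rintegral_ge0 => y _.
  by case/andP: ((unit_valued_value_fun 0).2 y).
by apply: le_reach_op => //; [exact: unit_valued_value_fun|
  exact: (unit_valued_value_fun k.+1)].
Qed.

End reach_op.

(** * Shifted until events and the induction on the horizon *)

Section bounded_until.
Variables (Phi Psi : set X).
Hypotheses (mPhi : measurable Phi) (mPsi : measurable Psi).

Definition until_from (t n : nat) : set (path_space X) :=
  [set w | bounded_until Phi Psi n (fun i => w (t + i)%N : X)].

Lemma until_from0 n : until_from 0 n = bounded_until Phi Psi n.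
Proof. by []. Qed.

Lemma until_from_0r t : until_from t 0 = [set w | Psi (w t)].
Proof.
apply/seteqP; split => [w [i []]|w Pw] /=.
  by rewrite leqn0 => /eqP ->; rewrite addn0.
by exists 0%N; split => //=; rewrite addn0.
Qed.

(** A witness 0 falls on the left, a positive one moves down by one. Paths in [Psi] at time [t] all
    go left, so [Phi] can be cut down to [Phi] minus [Psi] and the union is disjoint. *)
Lemma until_fromS t n : until_from t n.+1 =
  [set w | Psi (w t)] `|` [set w | (Phi `\` Psi) (w t)] `&` until_from t.+1 n.
Proof.
apply/seteqP; split => [w [[|i] [ik Pi Phij]]|w [Pt|[[Pt _] [i [ik Pi Phij]]]]].
- by left; rewrite /= addn0 in Pi *.
- have [Pt|nPt] := pselect (Psi (w t)); [by left|right]; split.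
    by split => //; have := Phij 0%N isT; rewrite addn0.
  exists i; split => //; first by rewrite addSnnS.
  by move=> j ji; rewrite addSnnS; exact: Phij.
- by exists 0%N; split => //=; rewrite addn0.
- exists i.+1; split => //; first by rewrite -addSnnS.
  by move=> [|j] ji; [rewrite addn0|rewrite -addSnnS; exact: Phij].
Qed.

Lemma measurable_until_from t n : measurable (until_from t n).
Proof.
elim: n t => [|n IH] t; first by rewrite until_from_0r; exact: measurable_at.
rewrite until_fromS; apply: measurableU; first exact: measurable_at.
by apply: measurableI => //; apply: measurable_at; exact: measurableD.
Qed.

Local Open Scope ereal_scope.

Lemma integral_value_fun (Q : R.-pker X ~> X) (x : X)
    (P : probability (path_space X) R) (t n : nat) : markov_law Q x P ->
  \int[P]_(w in stays_in (Phi `\` Psi) t) (value_fun Q Phi Psi n (w t))%:E =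
  P (until_from t n `&` stays_in (Phi `\` Psi) t).
Proof.
move=> lawP; set S := stays_in _.
have mS i : measurable (S i) by apply: measurable_stays_in; exact: measurableD.
elim: n t => [|n IH] t.
  by rewrite until_from_0r -integral_indic//; exact: measurable_at.
have uV := unit_valued_value_fun Q mPhi mPsi n.
have mV : measurable_fun setT (EFin \o value_fun Q Phi Psi n).
  by apply/measurable_EFinP; exact: uV.1.
have V0 y : 0 <= (value_fun Q Phi Psi n y)%:E.
  by rewrite lee_fin; case/andP: (uV.2 y).
have untilE : P (until_from t n.+1 `&` S t) =
    P ([set w | Psi (w t)] `&` S t) + P (until_from t.+1 n `&` S t.+1).
  rewrite until_fromS setIUl measureU; last 3 first.
  - by apply: measurableI => //; exact: measurable_at.
  - apply: measurableI => //; apply: measurableI.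
      by apply: measurable_at; exact: measurableD.
    exact: measurable_until_from.
  - by apply/seteqP; split => // w [[? _] [[[]]]].
  rewrite setIAC [X in X `&` until_from _ _]setIC -stays_inS -/(S _).
  by rewrite (setIC (S t.+1)).
have stepE : P (until_from t.+1 n `&` S t.+1) =
    \int[P]_(w in S t.+1) \int[Q (w t)]_y (value_fun Q Phi Psi n y)%:E.
  rewrite -IH; apply: (markov_law_step lawP mV V0) => //.
  by apply: history_stays_in; exact: measurableD.
have mQV :
    measurable_fun setT (fun y => \int[Q y]_z (value_fun Q Phi Psi n z)%:E).
  by apply: measurable_fun_integral_kernel => // B; exact: measurable_kernel.
rewrite untilE stepE -integral_indic//; last exact: measurable_at.
(* The condition at time [t] moves from the domain into the integrand. Both integrals then run over
   [S t], and the claim reduces to the pointwise formula for [reach_op]. *)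
rewrite [S t.+1]stays_inS integral_mkcondr -ge0_integralD//.
- apply: eq_integral => w _.
  rewrite [value_fun _ _ _ _ _]/= reach_opE patchE indicE.
  have memE B : (w \in [set w' : path_space X | B (w' t)]) = (w t \in B).
    by apply/idP/idP; rewrite !inE.
  rewrite !memE in_setD; case: (w t \in Psi); rewrite /= ?(andbF, andbT).
    by rewrite adde0.
  by rewrite add0e; case: (w t \in Phi); rewrite ?Rintegral_unit_valued.
- by apply/measurable_EFinP; apply: measurable_indic; exact: measurable_at.
- by move=> w _; apply: erestrict_ge0 => w' _; exact: integral_ge0.
- apply: measurable_funTS.
  apply/(measurable_restrictT _
    (measurable_at _ (measurableD mPhi mPsi))).
  apply: measurable_funTS.
  exact: (measurable_comp_coordinate (g := fun y => \int[Q y]_z _)).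
Qed.

End bounded_until.
End reachability.

Theorem lemma4 (R : realType) (Y : topologicalType) (polY : polish R Y)
    (E : set Y) (borelE : <<s open >> E) (E0 : E !=set0)
    (Q : R.-pker (borel_space E0) ~> (borel_space E0))
    (Phi Psi : set (borel_space E0))
    (mPhi : measurable Phi) (mPsi : measurable Psi) :
  (forall (k : nat) (x : borel_space E0)
      (Px : probability (path_space (borel_space E0)) R),
    markov_law Q x Px ->
    (value_fun Q Phi Psi k x)%:E = Px (bounded_until Phi Psi k)) /\
  (forall x : borel_space E0,
    nondecreasing_seq (fun k : nat => value_fun Q Phi Psi k x)).
Proof.
split=> [k x Px lawPx|x]; last exact: nondecreasing_value_fun.
have [mV V01] := unit_valued_value_fun Q mPhi mPsi k.
(* At time 0 the constraint is vacuous, leaving the integral of V_k(X_0), which the initial law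
   evaluates at [x]. *)
have S0 : stays_in (Phi `\` Psi) 0 = setT by apply/seteqP; split.
rewrite -until_from0 -[in RHS](setIT (until_from _ _ _ _)) -S0.
rewrite -(integral_value_fun mPhi mPsi _ _ lawPx) S0.
rewrite (markov_law_initial lawPx (f := EFin \o value_fun Q Phi Psi k))//.
  exact/measurable_EFinP.
by move=> y; rewrite lee_fin; case/andP: (V01 y).
Qed.
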